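(* Let $n\ge 2$ be an integer, let $f_N$ be the number of order-$n$ ribbon tilings of the $n$-by-$N$ strip, and let $\mu_n=\lim_{N\to\infty}\frac{\ln f_N}{N}$. Then $$\frac1n\ln(n!)\le \mu_n\le \ln n .$$
   Context: Unit squares are $[x,x+1]\times[y,y+1]$ with $x,y\in\mathbb Z$. An order-$n$ ribbon tile is a set of $n$ unit squares forming a sequence in which each square after the first is the square immediately above or immediately to the right of its predecessor. An order-$n$ ribbon tiling of a region is a covering of the region by non-overlapping order-$n$ ribbon tiles contained in it. The strip of length $N$ is the rectangle $[0,N]\times[0,n]$. The limit defining $\mu_n$ exists (the sequence $\ln f_N$ is superadditive in $N$). *)

(* Defs.v *)
From mathcomp Require Import all_boot all_order all_algebra.

Set Implicit Arguments.
Unset Strict Implicit.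
Unset Printing Implicit Defensive.

(* The pair (x, y) stands for the unit square [x, x+1] x [y, y+1] of the
   rectangle [0, W] x [0, H]: x is the column, y the row. *)
Notation square W H := ('I_W * 'I_H)%type.

Definition next_square (W H : nat) : rel (square W H) :=
  fun p q => ((q.1 == p.1 :> nat) && (q.2 == p.2.+1 :> nat))
          || ((q.1 == p.1.+1 :> nat) && (q.2 == p.2 :> nat)).

Definition ribbon_tile (n W H : nat) (B : {set square W H}) : bool :=
  [exists s : n.-tuple (square W H),
     sorted (@next_square W H) s && (B == [set p in s])].

(* Since tiles are unions of unit squares, tiles that cover the region without
   overlapping are exactly the blocks of a partition of its squares. A tiling
   is the set of its tiles. *)
Definition ribbon_tiling (n W H : nat) (D : {set square W H})
    (P : {set {set square W H}}) : bool :=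
  partition P D && [forall B in P, ribbon_tile n B].

Definition num_strip_tilings (n N : nat) : nat :=
  #|[set P : {set {set square N n}} | ribbon_tiling n [set: square N n] P]|.

(* Imported only here: classical_sets redefines notations such as
   [partition] on which the finite sets above rely. *)
From mathcomp Require Import boolp classical_sets reals topology normedtype.
From mathcomp Require Import sequences exp.

Import Order.TTheory GRing.Theory Num.Theory.
Import numFieldNormedType.Exports.

Local Open Scope ring_scope.

Definition growth_seq (R : realType) (n : nat) : nat -> R :=
  fun N => ln (num_strip_tilings n N)%:R / N%:R.

Definition growth_rate (R : realType) (n : nat) : R :=
  limn (growth_seq R n).

(* Main.v *)
(* Call x + y the level of a square.  A tile meets n consecutive levels, each in
   one square, and counting the squares whose level is congruent to l modulo n
   shows that exactly one tile starts on each level l < N.  The rows of these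
   N starting squares determine the tiling, because the tiles meeting two
   consecutive diagonals cannot cross; so there are at most n ^ N tilings.
   Conversely a permutation of 'I_n, read as the order of the tiles along the
   diagonals, produces a tiling of the n-by-n square, and the main diagonal
   gives the permutation back, so that square has at least n! tilings.
   Juxtaposing strips makes ln f_N superadditive, and Fekete's lemma identifies
   the limit with the supremum of ln f_N / N. *)

Require Import Defs.
From mathcomp Require Import all_boot all_order all_algebra.
From mathcomp Require Import perm zify lra.

Set Implicit Arguments.
Unset Strict Implicit.
Unset Printing Implicit Defensive.

(** * Levels and starting squares *)

Definition level (W H : nat) (p : square W H) : nat := p.1 + p.2.

Lemma level_next (W H : nat) (p q : square W H) :
  next_square p q -> level q = (level p).+1.
Proof.
by rewrite /next_square /level => /orP[] /andP[/eqP-> /eqP->]; lia.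
Qed.

Lemma square_inj (W H : nat) (p q : square W H) :
  level p = level q -> p.2 = q.2 :> nat -> p = q.
Proof.
case: p q => [x y] [x' y'] /=; rewrite /level /= => e1 e2.
by congr pair; apply: val_inj => /=; lia.
Qed.

(** Each step of the sequence raises the level by one, so the place of a square in its tile is its
    level minus the least one. *)
Lemma ribbon_tileP (n W H : nat) (B : {set square W H}) :
  0 < n -> ribbon_tile n B ->
  exists l, [/\ forall p, p \in B -> l <= level p < l + n,
     forall m, l <= m < l + n -> exists2 p, p \in B & level p = m,
     {in B &, injective (@level W H)} &
     {in B &, forall p q, level q = (level p).+1 -> next_square p q}].
Proof.
move=> n0 /existsP[s /andP[ss /eqP ->]].
have ps := size_tuple s; pose p0 := nth (tnth s (Ordinal n0)) s 0.
have step i : i.+1 < n -> next_square (nth p0 s i) (nth p0 s i.+1).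
  by move=> lt_i; have /(sortedP p0) := ss; apply; rewrite ps.
have lev i : i < n -> level (nth p0 s i) = level (nth p0 s 0) + i.
  elim: i => [|i IHi] lt_i; first by rewrite addn0.
  by rewrite (level_next (step _ lt_i)) IHi ?addnS // ltnW.
have memP p : p \in [set p in s] -> exists2 i, i < n & p = nth p0 s i.
  by rewrite inE => /(nthP p0)[i]; rewrite ps => lt_i <-; exists i.
exists (level (nth p0 s 0)); split.
- by move=> p /memP[i lt_i ->]; rewrite (lev i) // leq_addr ltn_add2l.
- move=> m /andP[le_m lt_m]; have lt_i : m - level (nth p0 s 0) < n by lia.
  exists (nth p0 s (m - level (nth p0 s 0))); first by rewrite inE mem_nth ?ps.
  by rewrite (lev _ lt_i) subnKC.
- move=> _ _ /memP[i lt_i ->] /memP[j lt_j ->].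
  by rewrite (lev i) // (lev j) // => /addnI ->.
- move=> _ _ /memP[i lt_i ->] /memP[j lt_j ->].
  rewrite (lev i) // (lev j) // -addnS => /addnI e; move: lt_j; rewrite e; exact: step.
Qed.

(** On a tile of a tiling [level] is injective, so the minimum is attained once and serves as a
    canonical representative of the tile. *)
Definition start (W H : nat) (P : {set {set square W H}}) (q : square W H) :=
  [arg min_(p < q in pblock P q) level p].

Section Starts.
Variables (n N : nat) (P : {set {set square N n}}).
Hypotheses (n0 : 0 < n) (tilP : ribbon_tiling n [set: square N n] P).

Let partP : partition P [set: square N n].
Proof. by case/andP: tilP. Qed.

Let memq q : q \in pblock P q.
Proof. by rewrite mem_pblock (cover_partition partP) inE. Qed.

Let same q p : p \in pblock P q -> pblock P p = pblock P q.
Proof. exact: same_pblock (partition_trivIset partP). Qed.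

Let tile q : ribbon_tile n (pblock P q).
Proof.
case/andP: tilP => _ /forall_inP; apply; apply: pblock_mem.
by rewrite (cover_partition partP) inE.
Qed.

Lemma start_mem q : start P q \in pblock P q.
Proof. by rewrite /start; case: arg_minnP => //. Qed.

Lemma start_min q p : p \in pblock P q -> level (start P q) <= level p.
Proof. by move=> pq; rewrite /start; case: arg_minnP => // i _; apply. Qed.

Lemma pblock_level_inj q : {in pblock P q &, injective (@level N n)}.
Proof. by have [l []] := ribbon_tileP n0 (tile q). Qed.

Lemma pblock_next q : {in pblock P q &, forall p p', level p' = (level p).+1 ->
  next_square p p'}.
Proof. by have [l []] := ribbon_tileP n0 (tile q). Qed.

Lemma start_level_bounds q : level (start P q) <= level q < level (start P q) + n.
Proof.
have [l [bnd ex _ _]] := ribbon_tileP n0 (tile q).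
have [|p pq lp] := ex l; first by lia.
have := start_min pq; have := bnd _ (start_mem q); have := bnd _ (memq q); lia.
Qed.

Lemma pblock_level_ex q m : level (start P q) <= m < level (start P q) + n ->
  exists2 p, p \in pblock P q & level p = m.
Proof.
have [l [bnd ex _ _]] := ribbon_tileP n0 (tile q).
have [|p pq lp] := ex l; first by lia.
have := start_min pq; have := bnd _ (start_mem q) => b1 b2 b3.
by apply: ex; lia.
Qed.

Lemma pblock_start q : pblock P (start P q) = pblock P q.
Proof. exact: same (start_mem q). Qed.

Lemma eq_start q p : (start P q = start P p) <-> (p \in pblock P q).
Proof.
split=> [e|/same pq]; first by rewrite -pblock_start e pblock_start.
apply: (@pblock_level_inj q); rewrite ?start_mem // -?pq ?start_mem //.
by apply/eqP; rewrite eqn_leq !start_min // ?pq -?pq ?start_mem // pq start_mem.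
Qed.

Lemma startK q : start P (start P q) = start P q.
Proof. by apply/eq_start; rewrite pblock_start. Qed.

(* A tile starting at a level < L covers exactly one square whose level is < L
   and congruent to L-1 modulo n; these squares are one per column x < L. *)
Lemma card_starts_below L :
  #|[set q | (start P q == q) && (level q < L)]| = #|[set x : 'I_N | x < L]|.
Proof.
case: L => [|l].
  by apply: etrans (_ : 0 = _); [|apply: esym]; apply: eq_card0 => x;
    rewrite !inE ?andbF.
(* In a column x <= l, the only square whose level is at most l and congruent to l modulo n lies in
   row (l - x) mod n. *)
pose h (x : 'I_N) : square N n := (x, Ordinal (ltn_pmod (l - x) n0)).
have hP q : reflect (exists2 x : 'I_N, x < l.+1 & q = h x)
                    ((level q <= l) && (n %| l - level q)).
  apply: (iffP andP) => [[le_l dv]|[x lt_x ->]]; last first.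
    have := divn_eq (l - x) n; rewrite /level /= => e.
    split; first by have := leq_mod (l - x) n; move: lt_x; rewrite ltnS; lia.
    by rewrite subnDA {1}e addnK dvdn_mull.
  exists q.1; first by move: le_l; rewrite /level; lia.
  apply: square_inj; last first.
    case/dvdnP: dv => k /= e.
    have -> : l - q.1 = k * n + q.2 by move: le_l e; rewrite /level; lia.
    by rewrite modnMDl modn_small.
  rewrite /level /=.
    case/dvdnP: dv => k /= e.
    have -> : l - q.1 = k * n + q.2 by move: le_l e; rewrite /level; lia.
    by rewrite modnMDl modn_small.
pose D := [set q : square N n | (level q <= l) && (n %| l - level q)].
have -> : [set q | (start P q == q) && (level q < l.+1)] = start P @: D.
  apply/setP=> q; rewrite inE ltnS; apply/andP/imsetP => [[/eqP sq le_l]|[p]].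
    (* Climbing (l - level q) mod n < n levels inside the tile started by [q] reaches the class of l
       without exceeding l. *)
    have [|p pq lp] := @pblock_level_ex q (level q + (l - level q) %% n).
      by rewrite sq leq_addr ltn_add2l ltn_pmod.
    exists p; last by rewrite -[LHS]sq; apply/eq_start.
    rewrite inE lp; have e := divn_eq (l - level q) n.
    rewrite subnDA {2}e addnK dvdn_mull // andbT.
    by have := leq_mod (l - level q) n; lia.
  rewrite inE => /andP[le_l _] ->; rewrite startK eqxx; split=> //.
  by have := start_level_bounds p; lia.
rewrite card_in_imset; last first.
  move=> p q; rewrite !inE => /andP[lp dp] /andP[lq dq] e.
  have pq : p \in pblock P q by apply/eq_start.
  apply: (@pblock_level_inj q) => //.
  have := start_level_bounds p; have := start_level_bounds q; rewrite e => bq bp.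
  (* Levels in one tile differ by less than n, so two of them that are congruent modulo n
     coincide. *)
  have aux a b : a <= b -> b <= l -> b < a + n -> n %| l - a -> n %| l - b -> a = b.
    move=> le_ab le_bl lt_b da db; have: n %| b - a.
      have -> : b - a = (l - a) - (l - b) by clear da db; lia.
      exact: dvdn_sub.
    have [|gt0 /(dvdn_leq gt0)] := posnP (b - a); clear da db; lia.
  move: lp dp lq dq bp bq => lp dp lq dq /andP[le_bp lt_bp] /andP[le_bq lt_bq].
  have bnd1 : level q < level p + n by apply: leq_trans lt_bq _; rewrite leq_add2r.
  have bnd2 : level p < level q + n by apply: leq_trans lt_bp _; rewrite leq_add2r.
  have [le|/ltnW le] := leqP (level p) (level q); [|apply: esym]; exact: aux.
have -> : D = h @: [set x : 'I_N | x < l.+1].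
  apply/setP=> q; rewrite inE; apply/hP/imsetP => [[x lx ->]|[x]].
    by exists x; rewrite ?inE.
  by rewrite inE => lx ->; exists x.
by rewrite card_imset // => x y [].
Qed.

(** Subtract the counts below l from those below l + 1, for starts and for columns; only the column
    x = l, if there is one, remains. *)
Lemma card_starts_level l :
  #|[set q | (start P q == q) && (level q == l)]| = (l < N).
Proof.
have split_card (T : finType) (A : pred T) (g : T -> nat) :
    #|[set x | A x && (g x < l.+1)]| =
    #|[set x | A x && (g x < l)]| + #|[set x | A x && (g x == l)]|.
  rewrite -cardsUI [X in _ + #|pred_of_set X|](_ : _ = set0) ?cards0 ?addn0.
    by apply: eq_card => x; rewrite !inE; case: (A x) => //=; lia.
  by apply/setP=> x; rewrite !inE; case: (A x) => //=; lia.
have /= := split_card _ predT (fun x : 'I_N => x : nat).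
have := split_card _ (fun q => start P q == q) (@level N n).
rewrite !card_starts_below => -> /addnI ->.
case: ltnP => lN; last first.
  by apply: eq_card0 => x; rewrite !inE; have := ltn_ord x; lia.
by apply: etrans (cards1 (Ordinal lN)); apply: eq_card => x; rewrite !inE -val_eqE.
Qed.

Lemma start_level_lt q : level (start P q) < N.
Proof.
have := card_starts_level (level (start P q)); case: (_ < N) => // /cards0_eq/setP/(_ (start P q)).
by rewrite !inE startK !eqxx.
Qed.

Lemma start_ex l : l < N -> exists2 q, start P q = q & level q = l.
Proof.
move=> lN; have := card_starts_level l; rewrite lN => /eqP/cards1P[q /setP/(_ q)].
by rewrite !inE eqxx => /andP[/eqP ? /eqP ?]; exists q.
Qed.

Lemma start_uniq p q : start P p = p -> start P q = q -> level p = level q -> p = q.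
Proof.
move=> sp sq e; have := card_starts_level (level p).
have := start_level_lt p; rewrite sp => -> /eqP/cards1P[r /setP E].
have := E p; have := E q; rewrite !inE sp sq e !eqxx /=.
by move=> /esym/eqP -> /esym/eqP ->.
Qed.

End Starts.

(* Induct on (level, row): were the predecessors of q in P and in Q different,
   that of P would be the left neighbour of q and that of Q the lower one, and
   in P the latter would have to continue to the right neighbour r of itself,
   which lies below q on its diagonal; r and q would then share a tile of Q. *)
Lemma starts_determine_start (n N : nat) (P Q : {set {set square N n}}) :
  0 < n -> ribbon_tiling n [set: square N n] P ->
  ribbon_tiling n [set: square N n] Q ->
  (forall q, start P q = q <-> start Q q = q) -> start P =1 start Q.
Proof.
move=> n0 tP tQ PQ q.
(* The outer induction, on the level, handles predecessors of [q]; the inner one, on the row,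
   handles squares lower on the diagonal of [q]. *)
have [m] := ubnP (level q); elim: m q => // m IHm q; rewrite ltnS => lq.
have [k] := ubnP (q.2 : nat); elim: k q lq => // k IHk q lq; rewrite ltnS => rq.
have [sPq|/eqP nsP] := eqVneq (start P q) q.
  by rewrite sPq; apply/esym/PQ.
have nsQ : start Q q <> q by move=> /PQ.
have pred R : ribbon_tiling n [set: square N n] R -> start R q <> q ->
    exists p, [/\ start R p = start R q, next_square p q & level p < m].
  move=> tR nsR; have bR := start_level_bounds n0 tR q.
  have lt_l : level (start R q) < level q.
    rewrite ltn_neqAle; case/andP: bR => -> _; rewrite andbT; apply/eqP => e.
    apply: nsR; apply: (pblock_level_inj n0 tR (q := q)) => //.
      exact: start_mem.
    by apply/(eq_start n0 tR).
  have [|p pq lp] := pblock_level_ex n0 tR (q := q) (m := (level q).-1); first by lia.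
  exists p; split; last by lia.
    exact/esym/(eq_start n0 tR).
  apply: (pblock_next n0 tR pq); last by rewrite lp; lia.
  by apply/(eq_start n0 tR).
have succ R p : ribbon_tiling n [set: square N n] R -> (level p).+1 < level (start R p) + n ->
    exists p', [/\ start R p' = start R p, next_square p p' & level p' = (level p).+1].
  move=> tR lt_l; have bR := start_level_bounds n0 tR p.
  have [|p' pq lp] := pblock_level_ex n0 tR (q := p) (m := (level p).+1); first by lia.
  exists p'; split=> //; first exact/esym/(eq_start n0 tR).
  apply: (pblock_next n0 tR _ pq) => //.
  by apply/(eq_start n0 tR).
have [p [epP npP lpm]] := pred P tP nsP; have [p' [epQ npQ lpm']] := pred Q tQ nsQ.
have eqp := IHm _ lpm; have eqp' := IHm _ lpm'.
have lp := level_next npP; have lp' := level_next npQ.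
have bP := start_level_bounds n0 tP q; have bQ := start_level_bounds n0 tQ q.
(* Here [a], left of [q], precedes it in [R], and [b], below [q], precedes it in [R']. Keeping [R]
   and [R'] general lets [P] and [Q] exchange roles. *)
have absurd R R' a b : ribbon_tiling n [set: square N n] R ->
    ribbon_tiling n [set: square N n] R' ->
    (forall r, level r = level q -> r.2 < q.2 -> start R r = start R' r) ->
    start R a = start R' a -> start R b = start R' b ->
    start R a = start R q -> start R' b = start R' q ->
    next_square a q -> next_square b q -> a.2 = q.2 :> nat ->
    b.2.+1 = q.2 :> nat -> False.
  move=> tR tR' IH ea eb eaq ebq na nb ra rb.
  have la := level_next na; have lb := level_next nb.
  have bR := start_level_bounds n0 tR q; have bR' := start_level_bounds n0 tR' q.
  (* The tile of [b] in [R] has the same start as the tile of [q] in [R'], so it also reaches the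
     level of [q] and continues past [b]. Going up, it would put [a] and [b], on one level, in the
     same tile; going right, it ends in the range of the inner induction. *)
  have [|r [er nr lr]] := succ R b tR; first by rewrite eb ebq; lia.
  have [rr|rr] : r.2 = q.2 :> nat \/ r.2 < q.2.
    by move: nr; rewrite /next_square; lia.
    have rq' : r = q by apply: square_inj => //; lia.
    subst r; have ab : a = b.
      apply: (pblock_level_inj n0 tR (q := q)); try (by apply/(eq_start n0 tR)); lia.
    by move: ra rb; rewrite ab; lia.
  have eqr : start R' r = start R' q by rewrite -IH //; [rewrite er eb ebq|lia].
  have rq' : r = q.
    apply: (pblock_level_inj n0 tR' (q := q)); try (by apply/(eq_start n0 tR')); lia.
  by move: rr; rewrite rq' ltnn.
have rows a : next_square a q -> a.2 = q.2 :> nat \/ a.2.+1 = q.2 :> nat.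
  by rewrite /next_square; lia.
have IH r : level r = level q -> r.2 < q.2 -> start P r = start Q r.
  by move=> er lr; apply: IHk; [rewrite er | exact: leq_trans lr rq].
case: (rows _ npP) (rows _ npQ) => [ra|ra] [rb|rb].
- have pp : p = p' by apply: square_inj; lia.
  by rewrite -epP -epQ -pp.
- by case: (absurd P Q p p').
- by case: (absurd Q P p' p) => // r er lr; rewrite IH.
- have pp : p = p' by apply: square_inj; lia.
  by rewrite -epP -epQ -pp.
Qed.

(** The tiles are the fibres of [start], so this map gives the partition back. *)
Lemma start_inj (n N : nat) (P Q : {set {set square N n}}) :
  0 < n -> ribbon_tiling n [set: square N n] P ->
  ribbon_tiling n [set: square N n] Q -> start P =1 start Q -> P = Q.
Proof.
move=> n0 tP tQ PQ.
have partP := andP tP; have partQ := andP tQ.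
rewrite -(preim_partition_pblock partP.1) -(preim_partition_pblock partQ.1).
suff e : pblock P =1 pblock Q.
  rewrite /preim_partition /equivalence_partition; apply: eq_imset => x.
  by apply/setP=> y; rewrite !inE !e.
move=> q; apply/setP=> p; apply/idP/idP => /eq_start-/(_ n0 _).
  by move=> /(_ tP) e; apply/(eq_start n0 tQ); rewrite -!PQ.
by move=> /(_ tQ) e; apply/(eq_start n0 tP); rewrite !PQ.
Qed.

Lemma num_strip_tilings_le (n N : nat) : 0 < n -> num_strip_tilings n N <= n ^ N.
Proof.
move=> n0; rewrite /num_strip_tilings -[X in _ <= X ^ _](card_ord n).
rewrite -[X in _ <= _ ^ X](card_ord N) -card_ffun.
(* The code records the row of the starting square on each level l < N. For a tiling such a square
   always exists, so the default is never reached. *)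
pose code (P : {set {set square N n}}) : {ffun 'I_N -> 'I_n} :=
  [ffun l : 'I_N => if [pick q | (start P q == q) && (level q == l)] is Some q
            then q.2 else Ordinal n0].
rewrite -(card_in_imset (f := code)); first exact: max_card.
have codeP P q : ribbon_tiling n [set: square N n] P ->
    start P q = q <-> exists2 l : 'I_N, level q = l & q.2 = code P l.
  move=> tP; split=> [sq|[l lq]].
    have lN := start_level_lt n0 tP q; rewrite sq in lN.
    exists (Ordinal lN) => //; rewrite ffunE; case: pickP => [q' /andP[/eqP sq' /eqP lq']|/(_ q)].
      by rewrite (start_uniq n0 tP sq sq').
    by rewrite sq !eqxx.
  rewrite ffunE; case: pickP => [q' /andP[/eqP sq' /eqP lq'] e|no].
    by have -> : q = q' by apply: square_inj; [rewrite lq | rewrite e].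
  have [q' sq' lq'] := start_ex n0 tP (ltn_ord l).
  by have := no q'; rewrite sq' lq' !eqxx.
move=> P Q; rewrite !inE => tP tQ e; apply: (start_inj n0) => //.
apply: starts_determine_start => // q.
by split=> /codeP - /(_ _ ) => H; apply/codeP => //; move: H; rewrite e; apply.
Qed.

(** * Tilings of the square from permutations *)

Lemma card_ord_below (n m : nat) : #|[set j : 'I_n | j < m]| = minn m n.
Proof.
have le := geq_minr m n.
have inj : injective (widen_ord le) by move=> i j /(congr1 val) e; apply: val_inj.
have <- : #|widen_ord le @: predT| = minn m n by rewrite card_imset ?card_ord.
apply: eq_card => j; rewrite inE; apply/idP/imsetP => [lt_j|[k _ ->]] /=.
  have lt_j' : j < minn m n by have := ltn_ord j; lia.
  by exists (Ordinal lt_j') => //; apply: val_inj.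
by have := ltn_ord k; lia.
Qed.

Lemma mktuple_ribbon_tile (n W H : nat) (f : nat -> square W H) :
  (forall k, k.+1 < n -> next_square (f k) (f k.+1)) ->
  ribbon_tile n [set f k | k : 'I_n].
Proof.
move=> next; apply/existsP; exists [tuple f k | k < n]; apply/andP; split.
  case: n next => [|n] next; first by rewrite tuple0.
  have tupleE j : j < n.+1 -> nth (f 0) [tuple f k | k < n.+1] j = f j.
    by move=> lt_j; rewrite -[j]/(val (Ordinal lt_j)) -tnth_nth tnth_mktuple.
  apply/(sortedP (f 0)) => i; rewrite size_tuple => lt_i.
  rewrite !tupleE // ?(ltnW lt_i) //.
  exact: next.
by apply/eqP/setP=> p; rewrite inE; apply/imsetP/mapP => [[k _ ->]|[k _ ->]];
  exists k; rewrite // mem_enum.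
Qed.

Section Square.
Variable n' : nat.
Let n := n'.+1.

(* The cardinal of this set is the row of tile i on the diagonal of level l.
   The tiles j with j + n <= l have ended before that diagonal; they account
   for the l - n + 1 bottom rows, which it no longer meets. *)
Definition front (s : 'S_n) (i : 'I_n) (l : nat) : {set 'I_n} :=
  [set j : 'I_n | (j + n <= l) || (s j < s i) && (j <= l)].

Definition tile_row (s : 'S_n) (i : 'I_n) l := #|front s i l|.

(** Tile [i] occupies the levels from i to i + n - 1, and [s i] is its rank from bottom to top. On
    these levels [inord] does not fall back on its default. *)
Definition tile_square (s : 'S_n) (i : 'I_n) l : square n n :=
  (inord (l - tile_row s i l), inord (tile_row s i l)).

Definition perm_tile (s : 'S_n) (i : 'I_n) := [set tile_square s i (i + k) | k : 'I_n].

Definition perm_tiling (s : 'S_n) := [set perm_tile s i | i : 'I_n].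

(** The front misses [i] itself, which bounds the row by n - 1 and by l; it contains all tiles
    already ended, which bounds the column. *)
Lemma tile_row_bounds (s : 'S_n) (i : 'I_n) l : i <= l < i + n ->
  [/\ tile_row s i l < n, tile_row s i l <= l & l - tile_row s i l < n].
Proof.
move=> /andP[le_il lt_l]; have lt_i := ltn_ord i.
have ni : i \notin front s i l by rewrite inE ltnn /=; lia.
have row_n : tile_row s i l < n.
  rewrite -[X in _ < X]card_ord -cardsT; apply: proper_card; rewrite properEneq subsetT andbT.
  by apply: contraNneq ni => ->; rewrite inE.
have row_l : tile_row s i l < l.+1.
  have := card_ord_below n l.+1 => c.
  apply: (@leq_trans (minn l.+1 n)); last exact: geq_minl.
  rewrite -c; apply: proper_card; apply/properP; split.
    by apply/subsetP=> j; rewrite !inE => /orP[|/andP[_]]; lia.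
  by exists i => //; rewrite inE.
split=> //.
have : minn (l.+1 - n) n <= tile_row s i l.
  rewrite -card_ord_below; apply: subset_leq_card; apply/subsetP=> j; rewrite !inE.
  by lia.
by lia.
Qed.

Lemma tile_squareE (s : 'S_n) (i : 'I_n) l : i <= l < i + n ->
  [/\ (tile_square s i l).1 = l - tile_row s i l :> nat,
      (tile_square s i l).2 = tile_row s i l :> nat &
      level (tile_square s i l) = l].
Proof.
move=> /(tile_row_bounds s)[r1 r2 r3].
by rewrite /level /tile_square /= !inordK // subnK.
Qed.

(** From level l to l + 1 no index leaves the front, and only l + 1 or l + 1 - n can enter; exactly
    one of these lies between 0 and n - 1. *)
Lemma tile_row_step (s : 'S_n) (i : 'I_n) l : l.+1 < n + n ->
  tile_row s i l.+1 = tile_row s i l \/ tile_row s i l.+1 = (tile_row s i l).+1.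
Proof.
move=> lt_l.
have le1 : tile_row s i l <= tile_row s i l.+1.
  by apply: subset_leq_card; apply/subsetP=> j; rewrite !inE => /orP[|/andP[->]]; lia.
have : tile_row s i l.+1 <= (tile_row s i l).+1.
  pose j0 : 'I_n := inord (if l.+1 < n then l.+1 else l.+1 - n).
  apply: (@leq_trans #|j0 |: front s i l|); last first.
    by rewrite cardsU1; case: (_ \notin _); rewrite ?add1n ?add0n.
  apply: subset_leq_card; apply/subsetP=> j; rewrite !inE -val_eqE /=.
  have := ltn_ord j; rewrite inordK; last by case: ifP; lia.
  by case: ifP => lt_l1 lt_j /orP[|/andP[->]]; lia.
by lia.
Qed.

Lemma tile_row_ltn (s : 'S_n) (i j : 'I_n) l : i <= l < i + n -> s i < s j ->
  tile_row s i l < tile_row s j l.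
Proof.
move=> /andP[le_il lt_l] lt_s; apply: proper_card; apply/properP; split.
  apply/subsetP=> k; rewrite !inE => /orP[->//|/andP[lt_k ->]].
  by rewrite (ltn_trans lt_k lt_s) orbT.
by exists i; rewrite !inE ?lt_s ?le_il ?orbT // ltnn /= orbF -ltnNge.
Qed.

(** The level gives l = m, and on one diagonal the row is strictly increasing in the rank [s i]. *)
Lemma tile_square_inj (s : 'S_n) (i j : 'I_n) l m : i <= l < i + n -> j <= m < j + n ->
  tile_square s i l = tile_square s j m -> i = j /\ l = m.
Proof.
move=> bi bj e; have [_ ri li] := tile_squareE s bi; have [_ rj lj] := tile_squareE s bj.
have lm : l = m by rewrite -li e.
subst m; split=> //; apply: (@perm_inj _ s); apply: val_inj => /=.
have rr : tile_row s i l = tile_row s j l by rewrite -ri e.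
case: (ltngtP (s i) (s j)) => // lt_s.
  by have := tile_row_ltn bi lt_s; rewrite rr ltnn.
by have := tile_row_ltn bj lt_s; rewrite rr ltnn.
Qed.

Lemma perm_tileP (s : 'S_n) (i : 'I_n) p :
  reflect (exists2 l, i <= l < i + n & p = tile_square s i l)
          (p \in perm_tile s i).
Proof.
apply: (iffP imsetP) => [[k _ ->]|[l bl ->]].
  by exists (i + k) => //; rewrite leq_addr ltn_add2l ltn_ord.
have lt_k : l - i < n by lia.
by exists (Ordinal lt_k) => //=; rewrite subnKC //; case/andP: bl.
Qed.

Lemma card_perm_tile (s : 'S_n) i : #|perm_tile s i| = n.
Proof.
rewrite card_imset ?card_ord // => k k' /tile_square_inj[||_].
- by rewrite leq_addr ltn_add2l ltn_ord.
- by rewrite leq_addr ltn_add2l ltn_ord.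
by move=> /addnI/val_inj.
Qed.

(** Covering is obtained by counting: n disjoint tiles of n squares fill the n * n squares. *)
Lemma perm_tilingP (s : 'S_n) : ribbon_tiling n [set: square n n] (perm_tiling s).
Proof.
have disj i j : j != i -> [disjoint perm_tile s i & perm_tile s j].
  apply: contraNT => /pred0Pn[p /= /andP[/perm_tileP[l bl e] /perm_tileP[m bm]]].
  by rewrite e => /(tile_square_inj bl bm)[->].
have [|i _|part inj] := @indexed_partition _ _ [pred i : 'I_n | true] (perm_tile s).
- by move=> i j _ _; apply: disj.
- by rewrite -card_gt0 card_perm_tile.
apply/andP; split; last first.
  apply/forall_inP => _ /imsetP[i _ ->].
  apply: (@mktuple_ribbon_tile n n n (fun k => tile_square s i (i + k))) => k lt_k.
  have bi : i <= i + k < i + n by rewrite leq_addr ltn_add2l ltnW.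
  have bi' : i <= (i + k).+1 < i + n by rewrite -addnS leq_addr ltn_add2l.
  have [c r _] := tile_squareE s bi; have [c' r' _] := tile_squareE s bi'.
  have [_ b _] := tile_row_bounds s bi.
  rewrite addnS /next_square c r c' r'.
  by have [|->|->] := @tile_row_step s i (i + k); [have := ltn_ord i|..]; lia.
suff <- : cover (perm_tiling s) = [set: square n n] by [].
apply/eqP; rewrite eqEcard subsetT cardsT card_prod card_ord /=.
rewrite (card_uniform_partition (n := n) _ part).
  by rewrite card_in_imset ?card_ord.
by move=> _ /imsetP[i _ ->]; rewrite card_perm_tile.
Qed.

Lemma perm_tiling_inj : injective perm_tiling.
Proof.
move=> s t e.
(* Tile [i] has a square on level i, while tile [j] has none below level j; hence j <= i. Applying
   this in both directions matches the indices. *)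
have sub s1 s2 i : perm_tiling s1 = perm_tiling s2 ->
    exists2 j : 'I_n, perm_tile s1 i = perm_tile s2 j & j <= i.
  move=> e12; have : perm_tile s1 i \in perm_tiling s2 by rewrite -e12 imset_f.
  case/imsetP=> j _ eij; exists j => //.
  have bi : i <= i < i + n by rewrite leqnn /= -[X in X < _]addn0 ltn_add2l.
  have : tile_square s1 i i \in perm_tile s2 j by rewrite -eij; apply/perm_tileP; exists i.
  case/perm_tileP=> l /[dup] bl /andP[le_l _] /(congr1 (@level _ _)).
  by have [_ _ ->] := tile_squareE s1 bi; have [_ _ ->] := tile_squareE s2 bl => ->.
have eqt i : perm_tile s i = perm_tile t i.
  have [j ej le_ji] := sub s t i e; have [k ek le_kj] := sub t s j (esym e).
  have ik : i = k.
    have : tile_square s i i \in perm_tile s k.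
      by rewrite -ek -ej; apply/perm_tileP; exists i => //; lia.
    by case/perm_tileP => l bl /tile_square_inj[] //; lia.
  rewrite ej; congr perm_tile; apply/val_inj/eqP.
  by rewrite eqn_leq le_ji {1}ik.
(* On level n - 1 every tile has started and none has ended, so the front consists of the [u i]
   indices of smaller rank. *)
have rowE (u : 'S_n) i : tile_row u i n' = u i.
  rewrite /tile_row (_ : front u i n' = u @^-1: [set j : 'I_n | j < u i]).
    rewrite card_preimset; last exact: perm_inj.
    by rewrite card_ord_below; apply/minn_idPl/ltnW.
  by apply/setP=> j; rewrite !inE; have := ltn_ord j; lia.
apply/permP=> i; apply: val_inj => /=; rewrite -!rowE.
have bi : i <= n' < i + n by have := ltn_ord i; lia.
have : tile_square s i n' \in perm_tile t i by rewrite -eqt; apply/perm_tileP; exists n'.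
case/perm_tileP => l bl e'.
have [_ r l1] := tile_squareE s bi; have [_ r' l2] := tile_squareE t bl.
have ll : l = n' by rewrite -l1 e' l2.
by rewrite -r e' r' ll.
Qed.

Lemma fact_le_num_strip_tilings : n`! <= num_strip_tilings n n.
Proof.
have <- : #|'S_n| = n`! by rewrite card_Sn.
rewrite -(card_imset _ perm_tiling_inj); apply: subset_leq_card.
by apply/subsetP=> _ /imsetP[s _ ->]; rewrite inE perm_tilingP.
Qed.

End Square.

(** * Juxtaposition of strips *)

(** A single column is itself one vertical tile. *)
Lemma num_strip_tilings1_gt0 (n : nat) : 0 < n -> 0 < num_strip_tilings n 1.
Proof.
move=> n0; rewrite card_gt0; apply/set0Pn; exists [set setT]; rewrite inE.
have nt : [set: square 1 n] != set0.
  by apply/set0Pn; exists (ord0, Ordinal n0); rewrite inE.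
apply/andP; split.
  by rewrite /partition cover1 eqxx trivIset1 inE eq_sym nt.
apply/forall_inP => _ /set1P ->.
rewrite (_ : setT = [set ((ord0, insubd (Ordinal n0) (k : nat)) : square 1 n) | k : 'I_n]).
  apply: (@mktuple_ribbon_tile n 1 n (fun k => (ord0, insubd (Ordinal n0) k))) => k lt_k.
  by rewrite /next_square /= !val_insubd lt_k (ltnW lt_k) !eqxx.
apply/esym/setP=> -[x y]; rewrite [RHS]inE; apply/imsetP; exists y => //.
by congr pair; [rewrite ord1|apply: val_inj; rewrite val_insubd ltn_ord].
Qed.

Lemma imset_ribbon_tile (n W H W' H' : nat) (h : square W H -> square W' H')
    (B : {set square W H}) :
  {mono h : p q / next_square p q} -> ribbon_tile n B -> ribbon_tile n (h @: B).
Proof.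
move=> hh /existsP[s /andP[ss /eqP ->]]; apply/existsP; exists (map_tuple h s).
rewrite /= sorted_map (eq_sorted (e' := @next_square W H)) ?ss //=.
by apply/eqP/setP=> p; rewrite inE; apply/imsetP/mapP => [[q]|[q qs ->]];
  [rewrite inE; exists q|exists q; rewrite ?inE].
Qed.

(** Gluing is injective: tiles are nonempty, so one from the left strip never has the same image as
    one from the right strip. *)
Lemma num_strip_tilings_superM (n N M : nat) :
  num_strip_tilings n N * num_strip_tilings n M <= num_strip_tilings n (N + M).
Proof.
pose hl (p : square N n) : square (N + M) n := (lshift M p.1, p.2).
pose hr (p : square M n) : square (N + M) n := (rshift N p.1, p.2).
have injl : injective hl by move=> [x y] [x' y'] [e ->]; congr pair; apply: val_inj.
have injr : injective hr by move=> [x y] [x' y'] [/addnI e ->]; congr pair; apply: val_inj.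
have nextl : {mono hl : p q / next_square p q} by [].
have nextr : {mono hr : p q / next_square p q}.
  by move=> p q; rewrite /next_square /= -addnS !eqn_add2l.
have disj p q : hl p != hr q by apply/eqP=> -[]; have := ltn_ord p.1; lia.
pose glue (PQ : {set {set square N n}} * {set {set square M n}}) :=
  [set hl @: (B : {set square N n}) | B in PQ.1] :|: [set hr @: (B : {set square M n}) | B in PQ.2].
have tiles_ne0 L (P : {set {set square L n}}) B :
  ribbon_tiling n [set: square L n] P -> B \in P -> exists p, p \in B.
  by move=> /andP[part _] BP; apply/set0Pn; apply: (partition_neq0 part).
have memlr (A : {set square N n}) (B : {set square M n}) :
    hl @: A = hr @: B -> (exists p, p \in A) \/ (exists p, p \in B) -> False.
  move=> e [[p pA]|[p pB]].
    have : hl p \in hr @: B by rewrite -e imset_f.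
    by case/imsetP=> q _ /eqP; rewrite (negPf (disj p q)).
  have : hr p \in hl @: A by rewrite e imset_f.
  by case/imsetP=> q _ /esym/eqP; rewrite (negPf (disj q p)).
rewrite /num_strip_tilings -cardsX -(card_in_imset (f := glue)).
  apply: subset_leq_card; apply/subsetP=> _ /imsetP[[P Q] + ->].
  rewrite !inE /= => /andP[/andP[partP /forall_inP tP] /andP[partQ /forall_inP tQ]].
  apply/andP; split; last first.
    by apply/forall_inP => B /setUP[] /imsetP[A AP ->]; apply: imset_ribbon_tile; auto.
  move: partP partQ; rewrite -(imset_partition _ _ injl) -(imset_partition _ _ injr).
  case/and3P=> /eqP cP trP nP /and3P[/eqP cQ trQ nQ]; apply/and3P; split.
  - rewrite /cover bigcup_setU -/(cover _) -/(cover _) cP cQ.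
    apply/eqP/setP=> -[x y]; rewrite [RHS]inE; apply/setUP.
    by case: (split_ordP x) => z ->; [left|right]; apply/imsetP; exists (z, y).
  - apply: (trivIsetU trP trQ); rewrite cP cQ.
    apply/pred0P=> p /=; apply/negP => /andP[/imsetP[a _ ->] /imsetP[b _ /eqP]].
    by rewrite (negPf (disj a b)).
  - by rewrite inE negb_or nP.
move=> [P Q] [P' Q']; rewrite !inE /= => /andP[tP tQ] /andP[tP' tQ'] e.
have subl (R R' : {set {set square N n}}) S S' : ribbon_tiling n [set: square N n] R ->
   ribbon_tiling n [set: square M n] S' ->
    glue (R, S) = glue (R', S') -> R \subset R'.
  move=> tR tS' e'; apply/subsetP=> B BR.
  have : hl @: B \in glue (R', S') by rewrite -e' inE imset_f.
  case/setUP=> /imsetP[A AR]; first by move/(imset_inj injl) => ->.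
  by move/memlr=> []; left; apply: tiles_ne0 BR.
have subr R R' (S S' : {set {set square M n}}) : ribbon_tiling n [set: square M n] S ->
    glue (R, S) = glue (R', S') -> S \subset S'.
  move=> tS e'; apply/subsetP=> B BS.
  have : hr @: B \in glue (R', S') by rewrite -e' inE orbC imset_f.
  case/setUP=> /imsetP[A AS]; last by move/(imset_inj injr) => ->.
  by move/esym/memlr=> []; right; apply: tiles_ne0 BS.
congr pair; apply/eqP; rewrite eqEsubset.
  by rewrite (subl _ _ _ _ _ _ e) ?(subl _ _ _ _ _ _ (esym e)).
by rewrite (subr _ _ _ _ _ e) ?(subr _ _ _ _ _ (esym e)).
Qed.

Lemma num_strip_tilings_gt0 (n N : nat) : 0 < n -> 0 < num_strip_tilings n N.
Proof.
move=> n0; elim: N => [|N IHN]; last first.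
  rewrite -(addn1 N); apply: leq_trans _ (num_strip_tilings_superM n N 1).
  by rewrite muln_gt0 IHN num_strip_tilings1_gt0.
rewrite card_gt0; apply/set0Pn; exists set0; rewrite inE; apply/andP; split.
  have -> : [set: square 0 n] = set0 by apply/setP=> -[[]].
  by rewrite partition_set0.
by apply/forall_inP => B; rewrite inE.
Qed.

(** * Growth rate *)

From mathcomp Require Import boolp classical_sets reals topology normedtype.
From mathcomp Require Import sequences exp.
Import Order.TTheory GRing.Theory Num.Theory.
Import numFieldNormedType.Exports.
Local Open Scope classical_set_scope.
Local Open Scope ring_scope.

Lemma fekete (R : realType) (u : nat -> R) (C : R) :
  (forall N, 0 <= u N) -> (forall N M, u N + u M <= u (N + M)%N) ->
  (forall N, u N <= C * N%:R) ->
  (fun N => u N / N%:R) @ \oo --> sup [set u N.+1 / N.+1%:R | N in setT].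
Proof.
move=> u0 uD uC; set S := [set _ | _ in _]%classic.
have C0 : 0 <= C by have := le_trans (u0 1%N) (uC 1%N); rewrite mulr1.
have bS : has_sup S.
  split; first by exists (u 1%N / 1%:R), 0%N.
  by exists C => _ [N _ <-]; rewrite ler_pdivrMr ?ltr0n.
have uM k m : k%:R * u m <= u (k * m)%N.
  elim: k => [|k IHk]; first by rewrite mul0r.
  by rewrite mulSn -natr1 mulrDl mul1r addrC (le_trans _ (uD _ _)) // lerD2l.
apply/cvgrPdist_le => e e0.
have e20 : 0 < e / 2 by rewrite divr_gt0.
have [_ [m _ <-] ltm] := sup_adherent e20 bS.
near=> N.
have N0 : (0 < N)%N by near: N; exists 1%N.
have NR : 0 < N%:R :> R by rewrite ltr0n.
have le1 : u N / N%:R <= sup S.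
  by apply: (sup_upper_bound bS); exists N.-1; rewrite ?prednK.
have uN : u m.+1 / N%:R <= e / 2.
  rewrite ler_pdivrMr // mulrC -ler_pdivrMr //.
  by near: N; exact: nbhs_infty_ger.
(* With k = N div (m + 1), superadditivity gives k u(m+1) <= u(N), while N < (k + 1)(m + 1). *)
have le2 : u m.+1 / m.+1%:R - u m.+1 / N%:R <= u N / N%:R.
  rewrite lerBlDr -mulrDl ler_pdivlMr // mulrAC ler_pdivrMr ?ltr0n //.
  have le_k : (N %/ m.+1)%:R * u m.+1 <= u N.
    apply: le_trans (uM _ _) _; rewrite [in leRHS](divn_eq N m.+1).
    by apply: le_trans (uD _ _); rewrite lerDl.
  have le_N : N%:R <= ((N %/ m.+1)%:R + 1) * m.+1%:R :> R.
    by rewrite natr1 -natrM ler_nat ltnW // ltn_ceil.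
  apply: le_trans (ler_wpM2l (u0 _) le_N) _.
  by rewrite mulrA ler_wpM2r // mulrDr mulr1 mulrC lerD2r.
rewrite ger0_norm ?subr_ge0 //.
move: ltm le2 uN; move: (u m.+1 / _) (u m.+1 / _) (u N / _) (sup S) => a b c d; lra.
Unshelve. all: by end_near.
Qed.

Theorem theorem2 (R : realType) (n : nat) (hn : (2 <= n)%N) :
  cvgn (growth_seq R n) /\
  n%:R^-1 * ln (n`!)%:R <= growth_rate R n <= ln n%:R.
Proof.
have n0 : (0 < n)%N by exact: ltnW.
have f0 N : 0 < (num_strip_tilings n N)%:R :> R.
  by rewrite ltr0n num_strip_tilings_gt0.
pose u N : R := ln (num_strip_tilings n N)%:R.
have u0 N : 0 <= u N by rewrite ln_ge0 // ler1n num_strip_tilings_gt0.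
have uD N M : u N + u M <= u (N + M)%N.
  rewrite -lnM ?posrE // -natrM ler_ln ?posrE ?ler_nat ?num_strip_tilings_superM //.
  by rewrite natrM mulr_gt0.
have uC N : u N <= ln n%:R * N%:R.
  rewrite mulr_natr -lnXn ?ltr0n // -natrX ler_ln ?posrE ?ler_nat ?num_strip_tilings_le //.
  by rewrite ltr0n expn_gt0 n0.
have cv := fekete u0 uD uC.
have bnd N : u N.+1 / N.+1%:R <= ln n%:R by rewrite ler_pdivrMr ?ltr0n.
split; first by apply/cvg_ex; exists (sup [set u N.+1 / N.+1%:R | N in setT]).
rewrite /growth_rate (cvg_lim _ cv) //; apply/andP; split.
  have ub : has_sup [set u N.+1 / N.+1%:R | N in setT].
    by split; [exists (u 1%N / 1%:R), 0%N|exists (ln n%:R) => _ [N _ <-]].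
  (* The lower bound is the term N = n of the supremum, where the strip is the n-by-n square. *)
  apply: le_trans (_ : u n / n%:R <= _); last first.
    by apply: (sup_upper_bound ub); exists n.-1; rewrite ?prednK.
  rewrite mulrC ler_wpM2r ?invr_ge0 ?ler0n // ler_ln ?posrE ?ltr0n ?fact_gt0 //;
    last exact: num_strip_tilings_gt0.
  rewrite ler_nat; case: n n0 {hn f0 u u0 uD uC cv bnd ub} => // n _.
  exact: fact_le_num_strip_tilings.
apply: ge_sup; first by exists (u 1%N / 1%:R), 0%N.
by move=> _ [N _ <-].
Qed.
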